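(* Let $D$ be the center of an uncornered $A_3^8(1)$-polytope in $4_{21}$ and let $D_1$ be the corresponding skew $8$-line in $4_{21}$. The configuration of the $A_3^8(1)$-polytopes in $4_{21}$ with center $D$ equals the family of the subsets consisting of $4$ skew edges in the $7$-simplex with center $D_1$ in $4_{21}$.
   Context: $S_8$ is a del Pezzo surface (smooth, $-K_{S_8}$ ample) obtained by blowing up $\mathbb{P}^2$ at $8$ points, with canonical class $K_{S_8}$. A line is a class $l\in\mathrm{Pic}\,S_8$ with $l^2=l\cdot K_{S_8}=-1$; $L_8$ is the set of lines, which is the vertex set of the Gosset polytope $4_{21}$ (the convex hull of $L_8$ in $\mathrm{Pic}\,S_8\otimes\mathbb{Q}$). A skew $a$-line is a class $l_1+\dots+l_a$ with $l_1,\dots,l_a\in L_8$ distinct and $l_i\cdot l_j=0$ for $i\ne j$; the set $\{l_1,\dots,l_a\}$ is uniquely determined by the class and is the vertex set of an $(a-1)$-simplex of $4_{21}$, whose center is the class $l_1+\dots+l_a$. An edge of $4_{21}$ is identified with its skew $2$-line. Two edges are skew edges if they are disjoint and their skew $2$-lines have intersection number $0$; $4$ skew edges in a $7$-simplex are four edges of it that are pairwise skew. An $A_3^8(1)$-polytope in $4_{21}$ is given by four distinct lines in $L_8$ with pairwise intersection number $1$; its center is the sum of these lines. The vertex figure of $l\in L_8$ is $\{l'\in L_8: l'\cdot l=0\}$. An $A_3^8(1)$-polytope is cornered if there is a line $l\in L_8$ whose vertex figure contains all its lines, and uncornered otherwise. The center $D$ of an uncornered $A_3^8(1)$-polytope corresponds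 to the skew $8$-line $D_1=3D+4K_{S_8}$. The configuration of the $A_3^8(1)$-polytopes with a given center is the family of the sets of four lines forming them; ''equals'' is meant as an identification of such sets of four lines with sets of four edges. *)

(* Defs.v *)
From mathcomp Require Import all_boot all_order all_algebra finmap.
From mathcomp Require Import classical_sets functions.

Set Implicit Arguments.
Unset Strict Implicit.
Unset Printing Implicit Defensive.

Import Order.TTheory GRing.Theory Num.Theory.
Local Open Scope ring_scope.
Local Open Scope classical_set_scope.

(* The Picard group of a blow-up of P^2 at 8 points, in the basis (h, e_1, ..., e_8):
   h is the pull-back of the class of a line of P^2 and e_i is the i-th exceptional
   class, so that h.h = 1, e_i.e_i = -1 and all other products vanish. *)
Notation Pic := 'rV[int]_9.

Definition inter (u v : Pic) : int :=
  u 0 ord0 * v 0 ord0 - \sum_(i < 8) u 0 (lift ord0 i) * v 0 (lift ord0 i).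

(* K = -3h + e_1 + ... + e_8 *)
Definition K : Pic := \row_(i < 9) (if i == ord0 then - 3 else 1).

Definition lines : set Pic := [set l | inter l l = -1 /\ inter l K = -1].

Definition center (P : {fset Pic}) : Pic := \sum_(l <- P) l.

Definition vertex_figure (l : Pic) : set Pic :=
  [set l' | lines l' /\ inter l' l = 0].

(* The (a-1)-simplices of 4_21 are encoded by their vertex sets. *)
Definition simplex (a : nat) (T : {fset Pic}) : Prop :=
  [/\ #|` T| = a, [set` T] `<=` lines &
      forall l l', l \in T -> l' \in T -> l != l' -> inter l l' = 0].

Definition skew_line (a : nat) (C : Pic) : Prop :=
  exists2 T, simplex a T & center T = C.

Definition A3polytope (P : {fset Pic}) : Prop :=
  [/\ #|` P| = 4%N, [set` P] `<=` lines &
      forall l l', l \in P -> l' \in P -> l != l' -> inter l l' = 1].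

Definition cornered (P : {fset Pic}) : Prop :=
  exists2 l, lines l & [set` P] `<=` vertex_figure l.

Definition configuration (D : Pic) : set {fset Pic} :=
  [set P | A3polytope P /\ center P = D].

Definition configuration_lines (D : Pic) : set Pic :=
  [set l | exists2 P, configuration D P & l \in P].

Definition edges (T : {fset Pic}) : set {fset Pic} :=
  [set E | simplex 2 E /\ (E `<=` T)%fset].

Definition skew_edges (E E' : {fset Pic}) : Prop :=
  [disjoint E & E']%fset /\ inter (center E) (center E') = 0.

Definition four_skew_edges (T : {fset Pic}) : set {fset {fset Pic}} :=
  [set F | [/\ #|` F| = 4%N, [set` F] `<=` edges T &
      forall E E', E \in F -> E' \in F -> E != E' -> skew_edges E E']].

(* An identification of the lines of the configuration with center D with the
   edges of T: the line l is identified with the edge whose skew 2-line is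
   D + K - l.  In a basis where the vertices of T are e_1, ..., e_8 one has
   D = 4h - e_1 - ... - e_8 and D + K = h, so that the line h - e_i - e_j is
   identified with the edge joining e_i and e_j. *)
Definition line_edge_identification (D : Pic) (T : {fset Pic})
    (phi : Pic -> {fset Pic}) : Prop :=
  set_bij (configuration_lines D) (edges T) phi /\
  forall l, configuration_lines D l -> center (phi l) = D + K - l.

(* Main.v *)
Require Import Defs.
From mathcomp Require Import all_boot all_order all_algebra finmap.
From mathcomp Require Import perm zify ring.
From mathcomp Require Import classical_sets functions.

(** Put [v = D + K].  From the intersection numbers of the four lines one gets
    [v.v = 1] and [v.K = -3], as for the pull-back of a line of the plane, and
    [D_1 = 3v + K].  A simplex [T] with center [D_1] is thus the same thing as a
    system of eight disjoint lines with [K = -3v + sum of T]: a contraction to the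
    plane for which [v] is the class of a line (a [frame]).

    Given such a frame, [v] and [T] form an orthonormal basis of the Picard lattice
    ([frame_expansion]).  The lines occurring in a configuration with center [D]
    have product 1 with [v]; solving [l.l = l.K = -1] in the basis, they are exactly
    the classes [v - e - e'] with [e, e'] distinct in [T], i.e. the edges of [T].
    The product of two of them is [1 - |E :&: E'|] ([inter_edge_lines]), so lines
    meeting once correspond to disjoint edges, and four lines meeting pairwise once
    to four skew edges.  Conversely four such lines have center [D]: the difference
    of the two classes is isotropic and orthogonal to [v], where the form is
    negative definite ([A3polytope_center]).

    It remains to find a frame when the polytope is uncornered.  Cremona
    reflections preserve the form and [K] and lower the degree of [v] until Noether's
    inequality stops them ([frame_or_double]).  The final class is either the class
    of a line, which has the standard frame, or of the form [2l - K] with [l] a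
    line; in the latter case [l] corners the polytope ([double_cornered]). *)

Set Implicit Arguments.
Unset Strict Implicit.
Unset Printing Implicit Defensive.

Import Order.TTheory GRing.Theory Num.Theory.
Local Open Scope ring_scope.
Local Open Scope classical_set_scope.

(** * The intersection form *)

Definition minkowski : 'M[int]_9 :=
  diag_mx (\row_i (if i == ord0 then 1 else - 1)).

Lemma minkowskiK : minkowski *m minkowski = 1%:M.
Proof.
rewrite /minkowski mulmx_diag; apply/matrixP => i j; rewrite !mxE.
by case: ifP => _; rewrite ?mulrNN mulr1.
Qed.

Lemma interE u v : inter u v = (u *m minkowski *m v^T) 0 0.
Proof.
rewrite /minkowski mul_mx_diag !mxE big_ord_recl !mxE /= mulr1 /inter.
congr (_ + _); rewrite -sumrN; apply: eq_bigr => i _; rewrite !mxE /=.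
by rewrite mulrN1 mulNr.
Qed.

Lemma interC u v : inter u v = inter v u.
Proof.
rewrite /inter mulrC; congr (_ - _).
by apply: eq_bigr => i _; rewrite mulrC.
Qed.

Lemma interDl u v w : inter (u + v) w = inter u w + inter v w.
Proof. by rewrite !interE !mulmxDl mxE. Qed.

Lemma interZl a u w : inter (a *: u) w = a * inter u w.
Proof. by rewrite !interE -!scalemxAl mxE. Qed.

Lemma interNl u w : inter (- u) w = - inter u w.
Proof. by rewrite -scaleN1r interZl mulN1r. Qed.

Lemma inter0l w : inter 0 w = 0.
Proof. by rewrite -(scale0r 0) interZl mul0r. Qed.

Lemma interDr u v w : inter w (u + v) = inter w u + inter w v.
Proof. by rewrite interC interDl !(interC _ w). Qed.

Lemma interZr a u w : inter w (a *: u) = a * inter w u.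
Proof. by rewrite interC interZl interC. Qed.

Lemma interNr u w : inter w (- u) = - inter w u.
Proof. by rewrite interC interNl interC. Qed.

Lemma interMnl u n w : inter (u *+ n) w = n%:R * inter u w.
Proof. by rewrite -scaler_nat interZl. Qed.

Lemma interMnr u n w : inter w (u *+ n) = n%:R * inter w u.
Proof. by rewrite -scaler_nat interZr. Qed.

Lemma inter_suml (I : Type) (r : seq I) (P : pred I) (F : I -> Pic) w :
  inter (\sum_(i <- r | P i) F i) w = \sum_(i <- r | P i) inter (F i) w.
Proof.
by apply: (big_morph (inter^~ w)) => [u v|]; [exact: interDl | exact: inter0l].
Qed.

Lemma inter_sumr (I : Type) (r : seq I) (P : pred I) (F : I -> Pic) w :
  inter w (\sum_(i <- r | P i) F i) = \sum_(i <- r | P i) inter w (F i).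
Proof. by rewrite interC inter_suml; apply: eq_bigr => i _; exact: interC. Qed.

Definition inter_lin :=
  (interDl, interDr, interNl, interNr, interZl, interZr, interMnl, interMnr).

Lemma KK : inter K K = 1.
Proof. by rewrite /inter !big_ord_recl big_ord0 !mxE. Qed.

(** An integral family with the Gram matrix [J] of the standard basis is a basis:
    the Gram relation [M J M^T = J] exhibits [J M^T J] as a right inverse of the
    square matrix [M], hence also as a left inverse, and this left inverse reads
    off the coordinates. *)
Lemma lorentz_expansion (f : 'I_9 -> Pic) (u : Pic) :
    (forall i j, inter (f i) (f j) = minkowski i j) ->
  u = \sum_i (minkowski i i * inter u (f i)) *: f i.
Proof.
move=> gram; pose M : 'M[int]_9 := \matrix_i f i.
have gramM : M *m minkowski *m M^T = minkowski.
  apply/matrixP => i j; rewrite -gram interE /minkowski !mul_mx_diag !mxE.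
  by apply: eq_bigr => k _; rewrite !mxE.
have /mulmx1C inv : M *m (minkowski *m M^T *m minkowski) = 1%:M.
  by rewrite !mulmxA gramM minkowskiK.
rewrite -[LHS]mulmx1 -inv !mulmxA mulmx_sum_row; apply: eq_bigr => i _.
rewrite rowK; congr (_ *: _); rewrite {2}/minkowski mul_mx_diag mxE.
rewrite mulrC interE; congr (_ * _); first by rewrite [RHS]mxE eqxx mulr1n.
by rewrite /minkowski mul_mx_diag !mxE; apply: eq_bigr => k _; rewrite !mxE.
Qed.

(** * Exceptional frames *)

(** A frame is another way of blowing the surface down to the plane: the eight
    disjoint lines of [T] are the exceptional curves and [v] is the pull-back of
    the class of a line.  The equation on the center is the formula for the
    canonical class, [K = -3v + sum of T]. *)
Definition frame (T : {fset Pic}) (v : Pic) : Prop :=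
  [/\ simplex 8 T, inter v v = 1 & center T = v *+ 3 + K].

Lemma simplex_inter a T x y : simplex a T -> x \in T -> y \in T ->
  inter x y = - (x == y)%:R.
Proof.
move=> [_ /(_ x) lT oT] xT yT; case: (altP (x =P y)) => [<-|xy].
  by have [] := lT xT.
by rewrite oT // oppr0.
Qed.

Lemma simplex_inter_center a T (E : {fset Pic}) x : simplex a T ->
  (E `<=` T)%fset -> x \in T -> inter (center E) x = - (x \in E)%:R.
Proof.
move=> sT /fsubsetP ET xT; rewrite inter_suml.
under eq_big_seq => y yE do rewrite (simplex_inter sT (ET y yE) xT) eq_sym.
rewrite sumrN; congr (- _); have [xE|xE] := boolP (x \in E).
  by rewrite (big_fsetD1 x) //= eqxx big_seq big1 ?addr0 // => y;
    rewrite !inE eq_sym => /andP[/negPf->].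
by rewrite big_seq big1 // => y yE; case: eqP => // xy; rewrite xy yE in xE.
Qed.

(** Pair the equation for the center with the line [e]: it gives
    [-1 = 3 v.e + e.K = 3 v.e - 1]. *)
Lemma frame_orthogonal T v e : frame T v -> e \in T -> inter v e = 0.
Proof.
move=> [sT vv cT] eT.
have := simplex_inter_center sT (fsubset_refl T) eT.
have [_ /(_ e eT)[_ eK] _] := sT.
rewrite cT eT !inter_lin (interC K) eK /=; lia.
Qed.

Lemma frame_expansion T v u : frame T v ->
  u = inter u v *: v - \sum_(e <- T) inter u e *: e.
Proof.
move=> fT; have [sT vv cT] := fT.
pose s := v :: T; have [sz_T _ _] := sT.
have nthT (i : 'I_8) : nth (0 : Pic) T i \in T by rewrite mem_nth // sz_T.
have gram (i j : 'I_9) : inter (nth (0 : Pic) s i) (nth 0 s j) = minkowski i j.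
  rewrite !mxE; case: (unliftP ord0 i) => [k|] ->;
    case: (unliftP ord0 j) => [l|] -> /=.
  - rewrite (simplex_inter sT) ?nthT // nth_uniq ?fset_uniq ?sz_T ?add0n //.
    by rewrite (inj_eq lift_inj) mulNrn.
  - by rewrite interC (frame_orthogonal fT) ?nthT // mulr0n.
  - by rewrite (frame_orthogonal fT) ?nthT.
  - by rewrite vv.
rewrite [LHS](lorentz_expansion _ gram).
rewrite big_ord_recl !mxE /= mulr1n mul1r; congr (_ + _).
rewrite -sumrN [RHS](big_nth 0) big_mkord [size _]sz_T.
by apply: eq_bigr => i _; rewrite !mxE eqxx mulr1n mulN1r scaleNr.
Qed.

Lemma frame_orthogonal_center T v (E : {fset Pic}) : frame T v ->
  (E `<=` T)%fset -> inter v (center E) = 0.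
Proof.
move=> fT /fsubsetP ET; rewrite inter_sumr big_seq big1 // => e /ET.
exact: frame_orthogonal.
Qed.

Lemma frame_K T v : frame T v -> inter v K = - 3.
Proof.
move=> fT; have := frame_orthogonal_center fT (fsubset_refl T).
by have [_ vv ->] := fT; rewrite !inter_lin vv; lia.
Qed.

Lemma frame_parseval T v u w : frame T v ->
  inter u w = inter u v * inter w v - \sum_(e <- T) inter u e * inter w e.
Proof.
move=> fT; rewrite {1}(frame_expansion u fT) !inter_lin (interC v) inter_suml.
by under eq_bigr => e _ do rewrite interZl (interC e).
Qed.

(** The orthogonal complement of [v] is spanned by [T], so the form is negative
    definite there. *)
Lemma frame_hodge_index T v w : frame T v ->
  inter w v = 0 -> inter w w = 0 -> w = 0.
Proof.
move=> fT wv; rewrite (frame_parseval _ _ fT) wv mul0r sub0r => /eqP.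
rewrite oppr_eq0 psumr_eq0 => [/allP we0|e _]; last by rewrite -expr2 sqr_ge0.
rewrite (frame_expansion w fT) wv scale0r sub0r big_seq big1 ?oppr0 // => e eT.
by move: (we0 e eT); rewrite /= mulf_eq0 orbb => /eqP ->; rewrite scale0r.
Qed.

(** * Lines of degree one in a frame are pairs of exceptional lines *)

Definition line_pair (T : {fset Pic}) (l : Pic) : {fset Pic} :=
  [fset e in T | inter l e == 1]%fset.

(** In a frame [(T, v)] these are the strict transforms [v - e - e'] of the lines
    of the plane through two of the eight points. *)
Definition degree1_lines (v : Pic) : set Pic :=
  [set l | lines l /\ inter l v = 1].

Lemma line_pair_sub T l : (line_pair T l `<=` T)%fset.
Proof. by apply/fsubsetP => e; rewrite !inE => /andP[]. Qed.

(** The multiplicities [m_e = l.e] satisfy [sum m_e = 2] (pair [l] with [K]) and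
    [sum m_e^2 = 2] (expand [l.l]).  Thus the nonnegative integers
    [m_e^2 - m_e] sum to zero, and every [m_e] is 0 or 1. *)
Lemma inter_line_frame T v l e : frame T v -> degree1_lines v l -> e \in T ->
  inter l e = (e \in line_pair T l)%:R.
Proof.
move=> fT [[ll lK] lv] eT.
have sum_m : \sum_(x <- T) inter l x = 2.
  have [_ _ cT] := fT; rewrite -inter_sumr -/(center T) cT.
  by rewrite !inter_lin lv lK; lia.
have sum_m2 : \sum_(x <- T) inter l x * inter l x = 2.
  by have := frame_parseval l l fT; rewrite ll lv; lia.
have m01 x : 0 <= inter l x * inter l x - inter l x by nia.
have /eqP : \sum_(x <- T) (inter l x * inter l x - inter l x) = 0.
  by rewrite big_split sumrN /= sum_m2 sum_m.
rewrite psumr_eq0 // => /allP /(_ e eT) /= me.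
rewrite !inE eT /=; move: (inter l e) me => m.
by rewrite -{3}[m]mulr1 -mulrBr mulf_eq0 subr_eq0 => /orP[] /eqP ->.
Qed.

Lemma center_line_pair T v l : frame T v -> degree1_lines v l ->
  center (line_pair T l) = v - l.
Proof.
move=> fT cl; have [_ lv] := cl.
rewrite {2}(frame_expansion l fT) lv scale1r opprB addrC subrK.
rewrite /center big_fset /= big_mkcond /= !big_seq; apply: eq_bigr => e eT.
rewrite (inter_line_frame fT cl eT) !inE eT /=.
by case: (inter l e == 1); rewrite ?scale1r ?scale0r.
Qed.

Lemma inter_centers a T (E E' : {fset Pic}) : simplex a T ->
  (E `<=` T)%fset -> (E' `<=` T)%fset ->
  inter (center E) (center E') = - #|` (E `&` E')%fset|%:R.
Proof.
move=> sT ET /fsubsetP E'T; rewrite inter_sumr.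
under eq_big_seq => y yE do rewrite (simplex_inter_center sT ET (E'T y yE)).
rewrite sumrN -natr_sum; congr (- _%:R).
have -> : (E `&` E' = [fset x in E' | x \in E])%fset.
  by apply/fsetP => x; rewrite !inE andbC.
by rewrite -sum1_size big_fset /= [RHS]big_mkcond.
Qed.

Lemma edgesP a T E : simplex a T ->
  edges T E <-> (E `<=` T)%fset /\ #|` E| = 2%N.
Proof.
move=> [_ lT oT]; split=> [[[]]|[ET cE]] //; split=> //; split=> //.
  by move=> x /= /(fsubsetP ET); exact: lT.
by move=> x y /(fsubsetP ET) xT /(fsubsetP ET); exact: oT.
Qed.

Lemma line_pair_edge T v l : frame T v -> degree1_lines v l ->
  edges T (line_pair T l).
Proof.
move=> fT cl; have [sT vv _] := fT; apply/(edgesP _ sT); split.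
  exact: line_pair_sub.
have := inter_centers sT (line_pair_sub T l) (line_pair_sub T l).
rewrite (center_line_pair fT cl) fsetIid.
by have [[ll _] lv] := cl; rewrite !inter_lin (interC v l) vv lv ll; lia.
Qed.

Lemma edge_line T v E : frame T v -> edges T E ->
  degree1_lines v (v - center E).
Proof.
move=> fT; have [sT vv cT] := fT => /(edgesP _ sT)[ET cE].
have cEE := inter_centers sT ET ET; rewrite fsetIid cE in cEE.
have vE := frame_orthogonal_center fT ET; have vK := frame_K fT.
have ETc := inter_centers sT ET (fsubset_refl T).
rewrite (fsetIidPl ET) cE cT !inter_lin (interC _ v) vE in ETc.
split; first split; rewrite /= !inter_lin ?(interC (center E) v) ?vE; lia.
Qed.

Lemma edge_lineK T v E : frame T v -> edges T E ->
  line_pair T (v - center E) = E.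
Proof.
move=> fT; have [sT _ _] := fT => /(edgesP _ sT)[ET cE].
apply/fsetP => e; rewrite !inE; have [eT|eT] := boolP (e \in T); last first.
  by apply/esym/negbTE; apply: contra eT; exact/fsubsetP.
rewrite !inter_lin (frame_orthogonal fT eT) (simplex_inter_center sT ET eT).
by case: (e \in E).
Qed.

Lemma inter_edge_lines T v E E' : frame T v -> edges T E -> edges T E' ->
  inter (v - center E) (v - center E') = 1 - #|` (E `&` E')%fset|%:R.
Proof.
move=> fT; have [sT vv _] := fT => /(edgesP _ sT)[ET _] /(edgesP _ sT)[ET' _].
have vE := frame_orthogonal_center fT.
rewrite !inter_lin (interC (center E) v) (inter_centers sT ET ET') vv ?vE //.
by rewrite oppr0 addr0 sub0r opprK.
Qed.

Lemma skew_edgesP a T E E' : simplex a T -> edges T E -> edges T E' ->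
  skew_edges E E' <-> #|` (E `&` E')%fset| = 0%N.
Proof.
move=> sT /(edgesP _ sT)[ET _] /(edgesP _ sT)[ET' _].
rewrite /skew_edges -fsetI_eq0 -cardfs_eq0 (inter_centers sT ET ET').
by split=> [[/eqP]|->].
Qed.

(** * Configurations are perfect matchings of the simplex *)

Lemma pairing_exists (X : choiceType) n (A : {fset X}) : #|` A| = n.*2 ->
  exists F : {fset {fset X}}, [/\ #|` F| = n,
    forall E, E \in F -> (E `<=` A)%fset /\ #|` E| = 2%N &
    forall E E', E \in F -> E' \in F -> E != E' -> [disjoint E & E']%fset].
Proof.
elim: n A => [|n IHn] A cA; first by exists fset0.
have /fset0Pn[x xA] : A != fset0 by rewrite -cardfs_gt0 cA.
have cAx : #|` (A `\ x)%fset| = n.*2.+1.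
  by move: cA; rewrite (cardfsD1 x) xA => -[].
have /fset0Pn[y yA] : (A `\ x)%fset != fset0 by rewrite -cardfs_gt0 cAx.
have cAxy : #|` (A `\ x `\ y)%fset| = n.*2.
  by move: cAx; rewrite (cardfsD1 y) yA => -[].
have [F [cF EF dF]] := IHn _ cAxy.
have dxy E : E \in F -> [disjoint [fset x; y] & E]%fset.
  move=> /EF[/fsubsetP EA _]; apply/fdisjointP => z; rewrite !inE => zxy.
  by apply/negP => /EA; rewrite !inE; case/orP: zxy => /eqP ->;
    rewrite eqxx ?andbF.
have xy : x != y by move: yA; rewrite !inE eq_sym => /andP[].
exists ([fset x; y] |` F)%fset; split.
- rewrite cardfsU1 cF; have [/dxy|//] := boolP (_ \in F).
  by move=> /fdisjointP /(_ x); rewrite !inE eqxx => /(_ isT).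
- move=> E /fset1UP[->|/EF[EA cE]].
    split; last by rewrite cardfs2 xy.
    by apply/fsubsetP => z; move: yA; rewrite !inE => /andP[_ yA] /orP[] /eqP->.
  split=> //; apply: fsubset_trans EA _.
  by apply: fsubset_trans (fsubD1set _ _) (fsubD1set _ _).
- move=> E E' /fset1UP[->|EE] /fset1UP[->|EE']; rewrite ?eqxx // => nE.
  + exact: dxy.
  + by rewrite fdisjoint_sym; exact: dxy.
  + exact: dF.
Qed.

Lemma sum_fset_const (X : choiceType) (P : {fset X}) (F : X -> int) c :
  (forall x, x \in P -> F x = c) -> \sum_(x <- P) F x = c * #|` P|%:Z.
Proof.
move=> Fc; rewrite (eq_big_seq (fun=> c)) //.
by rewrite big_const_seq count_predT iter_addr_0 -mulr_natr natz.
Qed.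

Lemma A3polytope_inter_center P x : A3polytope P -> x \in P ->
  inter x (center P) = 2.
Proof.
move=> [cP lP oP] xP; rewrite inter_sumr (big_fsetD1 x) //=.
have [-> _] := lP _ xP; rewrite (sum_fset_const (c := 1)).
  by move: cP; rewrite (cardfsD1 x) xP add1n => -[->].
by move=> y; rewrite !inE eq_sym => /andP[xy yP]; exact: oP.
Qed.

Lemma A3polytope_center_self P : A3polytope P ->
  inter (center P) (center P) = 8.
Proof.
move=> AP; have [cP _ _] := AP.
rewrite {1}/center inter_suml (sum_fset_const (c := 2)) ?cP // => x.
exact: A3polytope_inter_center.
Qed.

Lemma A3polytope_center_K P : A3polytope P -> inter (center P) K = - 4.
Proof.
move=> [cP lP _].
by rewrite inter_suml (sum_fset_const (c := -1)) ?cP // => x /lP[].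
Qed.

Lemma configuration_degree1 D P l : configuration D P -> l \in P ->
  degree1_lines (D + K) l.
Proof.
move=> [AP cP] lP; have [_ /(_ l lP)[ll lK] _] := AP.
by split=> //; rewrite /= !inter_lin -cP (A3polytope_inter_center AP lP) lK.
Qed.

(** The classes [center P] and [v - K] have the same self-intersection and the
    same product with [v] and with [K]; hence their difference is orthogonal to
    [v] and isotropic, so it vanishes by the Hodge index argument. *)
Lemma A3polytope_center T v P : frame T v -> A3polytope P ->
  [set` P] `<=` degree1_lines v -> center P = v - K.
Proof.
move=> fT AP Pv; have [_ vv _] := fT; have vK := frame_K fT.
have PP := A3polytope_center_self AP; have PK := A3polytope_center_K AP.
have [cP _ _] := AP.
have Pv4 : inter (center P) v = 4.
  by rewrite inter_suml (sum_fset_const (c := 1)) ?cP // => x /Pv[].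
apply/eqP; rewrite -subr_eq0; apply/eqP; apply: (frame_hodge_index fT);
  rewrite !inter_lin ?(interC K v) ?(interC v (center P))
    ?(interC K (center P)) ?PP ?Pv4 ?PK ?KK ?vv ?vK; lia.
Qed.

(** Disjoint edges give lines that meet once, by [inter_edge_lines]; that four
    of them have the required center is automatic. *)
Lemma four_skew_edges_configuration T v (F : {fset {fset Pic}}) :
  frame T v -> four_skew_edges T F ->
  configuration (v - K) [fset v - center E | E in F]%fset.
Proof.
move=> fT [cF eF sF]; have [sT _ _] := fT.
set P := [fset _ | _ in _]%fset.
have linesP : [set` P] `<=` degree1_lines v.
  by move=> _ /= /imfsetP[E EF ->]; exact: edge_line fT (eF _ EF).
have AP : A3polytope P.
  split; first 1 last.
  - by move=> l /linesP[].
  - move=> _ _ /imfsetP[E /= EF ->] /imfsetP[E' /= EF' ->] EE'.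
    rewrite (inter_edge_lines fT) //; [|exact: eF..].
    have /sF : E != E' by apply: contraNneq EE' => ->.
    by move=> /(_ EF EF') /(skew_edgesP sT (eF _ EF) (eF _ EF')) ->.
  - rewrite card_in_imfset //= => E E' EF EF' /(congr1 (line_pair T)).
    by rewrite !(edge_lineK fT) //; exact: eF.
by split=> //; exact: A3polytope_center fT AP linesP.
Qed.

(** Lines meeting once have disjoint pairs, again by [inter_edge_lines]. *)
Lemma configuration_four_skew_edges T D P :
  frame T (D + K) -> configuration D P ->
  four_skew_edges T [fset line_pair T l | l in P]%fset.
Proof.
move=> fT DP; have [[cP _ oP] _] := DP; have [sT _ _] := fT.
have conP l : l \in P -> degree1_lines (D + K) l := configuration_degree1 DP.
have edgeP l (lP : l \in P) := line_pair_edge fT (conP l lP).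
have pairK l : l \in P -> D + K - center (line_pair T l) = l.
  by move=> /conP /(center_line_pair fT) ->; rewrite subKr.
split.
- rewrite card_in_imfset //= => l l' lP lP' pll'.
  by rewrite -[l]pairK // pll' pairK.
- by move=> _ /= /imfsetP[l /= lP ->]; exact: edgeP.
- move=> _ _ /imfsetP[l /= lP ->] /imfsetP[l' /= lP' ->] pll'.
  apply/(skew_edgesP sT (edgeP l lP) (edgeP l' lP')).
  have := inter_edge_lines fT (edgeP l lP) (edgeP l' lP').
  rewrite !pairK // oP //; first lia.
  by apply: contraNneq pll' => ->.
Qed.

Lemma configuration_image T D : frame T (D + K) ->
  [set [fset line_pair T l | l in P]%fset | P in configuration D]
    = four_skew_edges T.
Proof.
move=> fT; apply/seteqP; split=> [_ [P DP <-]|F FT].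
  exact: configuration_four_skew_edges fT DP.
have := four_skew_edges_configuration fT FT; rewrite addrK => DP.
exists [fset D + K - center E | E in F]%fset => //.
have [_ eF _] := FT.
have pairK E : E \in F -> line_pair T (D + K - center E) = E.
  by move=> EF; exact: edge_lineK fT (eF _ EF).
apply/fsetP => E; apply/imfsetP/idP => [[_ /imfsetP[E' /= EF ->] ->]|EF].
  by rewrite pairK.
by exists (D + K - center E); rewrite ?pairK //=; apply/imfsetP; exists E.
Qed.

(** The six vertices outside [E] can be paired off, so every edge is reached by
    the lines of the configuration: this is the surjectivity of [line_pair]. *)
Lemma edge_in_four_skew_edges T E : simplex 8 T -> edges T E ->
  exists2 F, four_skew_edges T F & E \in F.
Proof.
move=> sT eE; have [ET cE] := (edgesP E sT).1 eE.
have cTE : #|` (T `\` E)%fset| = 3.*2.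
  by rewrite cardfsD (fsetIidPr ET) cE; have [-> _ _] := sT.
have [F [cF EF dF]] := pairing_exists cTE.
have dE E' : E' \in F -> [disjoint E & E']%fset.
  move=> /EF[/fsubsetP E'T _]; apply/fdisjointP_sym => z /E'T.
  by rewrite !inE => /andP[].
have eF E' : E' \in F -> edges T E'.
  move=> /EF[E'T cE']; apply/(edgesP _ sT); split=> //.
  exact: fsubset_trans E'T (fsubsetDl _ _).
exists (E |` F)%fset; last by rewrite !inE eqxx.
have eEF E' : E' \in (E |` F)%fset -> edges T E'.
  by move=> /fset1UP[->|/eF].
split.
- rewrite cardfsU1 cF; have [/dE|//] := boolP (E \in F).
  by rewrite -fsetI_eq0 fsetIid -cardfs_eq0 cE.
- exact: eEF.
- move=> E1 E2 E1F E2F nE; apply/(skew_edgesP sT (eEF _ E1F) (eEF _ E2F)).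
  apply/eqP; rewrite cardfs_eq0 fsetI_eq0.
  move: E1F E2F nE => /fset1UP[->|E1F] /fset1UP[->|E2F]; rewrite ?eqxx // => nE.
  + exact: dE.
  + by rewrite fdisjoint_sym; exact: dE.
  + exact: dF.
Qed.

Lemma line_pair_identification T D : frame T (D + K) ->
  line_edge_identification D T (line_pair T).
Proof.
move=> fT; have [sT _ _] := fT.
have conD l : configuration_lines D l -> degree1_lines (D + K) l.
  by move=> [P DP]; exact: configuration_degree1.
split; last by move=> l /conD /(center_line_pair fT).
split.
- by move=> l /conD; exact: line_pair_edge.
- move=> l l'; rewrite !inE => /conD cl /conD cl' pll'.
  by rewrite -[l](subKr (D + K)) -(center_line_pair fT cl) pll'
    (center_line_pair fT cl') subKr.
- move=> E eE; exists (D + K - center E); last exact: edge_lineK fT eE.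
  have [F FT EF] := edge_in_four_skew_edges sT eE.
  have := four_skew_edges_configuration fT FT; rewrite addrK => DP.
  exists [fset D + K - center E | E in F]%fset => //.
  by apply/imfsetP; exists E.
Qed.

(** * Existence of a frame: Noether's inequality and Cremona reflections *)

(** Noether's inequality, in contrapositive form, for the degree and the decreasing
    multiplicities of a class with [v.v = 1] and [v.K = -3].  Subtract
    [a = m2] from all multiplicities and [3a] from [d], that is, pass from [v] to
    [v + aK].  The shifted degree [d' = d - 3a] is at least
    [m0' + m1' >= 0] and the other shifted multiplicities are nonpositive, so the
    linear relation gives [2d' <= 3 - a]; with [d >= 1] this leaves [0 <= a <= 3]
    and a handful of values of [(d, m0, m1)].  The quadratic relation then selects
    the class of a line and one class of degree 3. *)
Lemma noether_sorted (d m0 m1 m2 m3 m4 m5 m6 m7 : int) :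
    0 < d -> [/\ m1 <= m0, m2 <= m1, m3 <= m2 & m4 <= m3] ->
    [/\ m5 <= m4, m6 <= m5 & m7 <= m6] -> m0 + m1 + m2 <= d ->
    m0 + m1 + m2 + m3 + m4 + m5 + m6 + m7 = 3 * d - 3 ->
    m0 * m0 + m1 * m1 + m2 * m2 + m3 * m3 + m4 * m4 + m5 * m5 + m6 * m6
      + m7 * m7 = d * d - 1 ->
  [/\ d = 1, m0 = 0 & m7 = 0] \/ [/\ d = 3, m0 = 1, m6 = 1 & m7 = - 1].
Proof.
move=> d0 [h1 h2 h3 h4] [h5 h6 h7] h8 s1 s2.
have m2_ge0 : 0 <= m2 by clear s2; lia.
have m2_le3 : m2 <= 3 by clear s2; lia.
have sq0 (m : int) : 0 <= m * m by rewrite -expr2 sqr_ge0.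
have [e|[e|[e|e]]] : m2 = 0 \/ m2 = 1 \/ m2 = 2 \/ m2 = 3 by lia.
all: move: s2 h2 h3 h8 s1; rewrite {m2 m2_ge0 m2_le3}e => s2 h2 h3 h8 s1.
- have ed : d = 1 by clear s2; lia.
  have [e0|[e0 e1]] : m0 = 0 \/ m0 = 1 /\ m1 = 0 by clear s2; lia.
    by left; split=> //; clear s2; lia.
  have := And5 (sq0 m3) (sq0 m4) (sq0 m5) (sq0 m6) (sq0 m7).
  by move: s2; rewrite e0 e1 ed => s2 [*]; lia.
- have [[ed [e0 e1]]|[ed [e0 e1]]] :
      d = 3 /\ m0 = 1 /\ m1 = 1 \/ d = 4 /\ m0 = 2 /\ m1 = 1.
    by clear s2; lia.
    move: s1 s2; rewrite ed e0 e1 => s1 s2; right.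
    have [[e6 e7]|[e6 e7]] : m6 = 1 /\ m7 = - 1 \/ m6 = 0 /\ m7 = 0.
    - by clear s2; lia.
    - by split.
    have [e3 e4 e5] : [/\ m3 = 1, m4 = 1 & m5 = 1] by split; clear s2; lia.
    by rewrite e3 e4 e5 e6 e7 in s2.
  have [e3 e4 e5 e6 e7] : [/\ m3 = 1, m4 = 1, m5 = 1, m6 = 1 & m7 = 1].
    by split; clear s2; lia.
  by rewrite e0 e1 e3 e4 e5 e6 e7 ed in s2.
- have [ed [e0 e1]] : d = 6 /\ m0 = 2 /\ m1 = 2 by clear s2; lia.
  have [e3 e4 e5 e6 e7] : [/\ m3 = 2, m4 = 2, m5 = 2, m6 = 2 & m7 = 1].
    by split; clear s2; lia.
  by rewrite e0 e1 e3 e4 e5 e6 e7 ed in s2.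
- have [ed [e0 e1]] : d = 9 /\ m0 = 3 /\ m1 = 3 by clear s2; lia.
  have [e3 e4 e5 e6 e7] : [/\ m3 = 3, m4 = 3, m5 = 3, m6 = 3 & m7 = 3].
    by split; clear s2; lia.
  by rewrite e0 e1 e3 e4 e5 e6 e7 ed in s2.
Qed.

(** The pull-back of the class of a line of the plane. *)
Definition hyperplane : Pic := delta_mx 0 ord0.
Definition exc (i : 'I_8) : Pic := delta_mx 0 (lift ord0 i).

Lemma inter_hyperplane u : inter u hyperplane = u 0 ord0.
Proof.
rewrite /inter !mxE eqxx mulr1 big1 ?subr0 // => i _.
by rewrite !mxE mulr0.
Qed.

Lemma inter_exc u i : inter u (exc i) = - u 0 (lift ord0 i).
Proof.
rewrite /inter !mxE mulr0 sub0r (bigD1 i) //= !mxE !eqxx mulr1.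
rewrite big1 ?addr0 // => j /negPf ji; rewrite !mxE (inj_eq lift_inj) ji.
by rewrite mulr0.
Qed.

Lemma hyperplane_self : inter hyperplane hyperplane = 1.
Proof. by rewrite inter_hyperplane mxE. Qed.

Lemma hyperplane_exc i : inter hyperplane (exc i) = 0.
Proof. by rewrite inter_exc mxE oppr0. Qed.

Lemma exc_exc i j : inter (exc i) (exc j) = - (i == j)%:R.
Proof. by rewrite inter_exc mxE eqxx (inj_eq lift_inj) eq_sym. Qed.

Lemma hyperplane_K : inter hyperplane K = - 3.
Proof. by rewrite interC inter_hyperplane mxE. Qed.

Lemma exc_K i : inter (exc i) K = - 1.
Proof. by rewrite interC inter_exc mxE. Qed.

Lemma standard_expansion u :
  u = inter u hyperplane *: hyperplane - \sum_i inter u (exc i) *: exc i.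
Proof.
apply/rowP => k; rewrite !mxE summxE inter_hyperplane.
case: (unliftP ord0 k) => [i|] ->; rewrite ?mulr0 ?mulr1 ?sub0r.
  rewrite (bigD1 i) //= big1 => [|j /negPf ji].
    by rewrite inter_exc !mxE !eqxx mulr1 addr0 opprK.
  by rewrite !mxE (inj_eq lift_inj) eq_sym ji mulr0.
by rewrite big1 ?subr0 // => i _; rewrite !mxE mulr0.
Qed.

Lemma standard_inter u v : inter u v =
  inter u hyperplane * inter v hyperplane
    - \sum_i inter u (exc i) * inter v (exc i).
Proof.
rewrite {1}/inter !inter_hyperplane; congr (_ - _).
by apply: eq_bigr => i _; rewrite !inter_exc mulrNN.
Qed.

Lemma standard_K : K = \sum_i exc i - hyperplane *+ 3.
Proof.
rewrite [LHS]standard_expansion interC hyperplane_K scaleNr scaler_nat addrC.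
congr (_ - _); rewrite -sumrN; apply: eq_bigr => i _.
by rewrite interC exc_K scaleN1r opprK.
Qed.

(** The reflection in a root, that is, in a class [a] with [a.a = -2]; the plus
    sign comes from the negative square. *)
Definition reflection (a u : Pic) : Pic := u + inter u a *: a.

Lemma inter_reflection a u w : inter a a = - 2 ->
  inter (reflection a u) (reflection a w) = inter u w.
Proof.
by move=> aa; rewrite /reflection !inter_lin (interC a w) aa; ring.
Qed.

Lemma reflectionK a u : inter a a = - 2 -> reflection a (reflection a u) = u.
Proof.
move=> aa; rewrite /reflection !inter_lin aa -addrA -scalerDl.
by rewrite [X in X *: _](_ : _ = 0) ?scale0r ?addr0 //; ring.
Qed.

Lemma reflection_fix a u : inter u a = 0 -> reflection a u = u.
Proof. by move=> ua; rewrite /reflection ua scale0r addr0. Qed.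

Lemma reflection_lines a l : inter a a = - 2 -> inter a K = 0 ->
  lines l -> lines (reflection a l).
Proof.
move=> aa aK [ll lK]; split; first by rewrite inter_reflection.
by rewrite -(reflection_fix (etrans (interC _ _) aK)) inter_reflection.
Qed.

Lemma simplex_reflection n a T : inter a a = - 2 -> inter a K = 0 ->
  simplex n T -> simplex n [fset reflection a x | x in T]%fset.
Proof.
move=> aa aK [cT lT oT]; split.
- rewrite card_imfset //=; exact: can_inj (fun u => reflectionK u aa).
- by move=> _ /= /imfsetP[l lT' ->]; apply: reflection_lines => //; exact: lT.
- move=> _ _ /imfsetP[l /= lP ->] /imfsetP[l' /= lP' ->] ll'.
  by rewrite inter_reflection // oT //; apply: contraNneq ll' => ->.
Qed.

Lemma center_reflection a (T : {fset Pic}) : inter a a = - 2 ->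
  center [fset reflection a x | x in T]%fset = reflection a (center T).
Proof.
move=> aa; rewrite /center big_imfset /=; last first.
  by move=> x y _ _; exact: can_inj (fun u => reflectionK u aa) _ _.
by rewrite /reflection inter_suml scaler_suml -big_split.
Qed.

Lemma reflectionMnD a u w n :
  reflection a (u *+ n + w) = reflection a u *+ n + reflection a w.
Proof.
rewrite /reflection !inter_lin scalerDl mulrnDl -!addrA; congr (_ + _).
by rewrite addrCA -scalerA scaler_nat.
Qed.

Lemma standard_frame : frame [fset exc i | i in 'I_8]%fset hyperplane.
Proof.
have exc_inj : injective exc.
  move=> i j eij; have := exc_exc i j; rewrite eij exc_exc eqxx.
  by case: eqP.
split; last 1 first.
- rewrite /center big_imfset /= => [|i j _ _]; last exact: exc_inj.
  by rewrite big_enum standard_K addrC subrK.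
- split.
  + by rewrite card_imfset //= size_enum_ord.
  + move=> _ /= /imfsetP[i _ ->]; split; last exact: exc_K.
    by rewrite /= exc_exc eqxx.
  + move=> _ _ /imfsetP[i _ ->] /imfsetP[j _ ->] ij; rewrite exc_exc.
    by rewrite (negPf (contraNneq _ ij)) // => ->.
- exact: hyperplane_self.
Qed.

(** Cauchy-Schwarz: the multiplicities satisfy [sum m_i = 3(d - 1)] and
    [sum m_i^2 = d^2 - 1], so [9 (d - 1)^2 <= 8 (d^2 - 1)], that is,
    [(d - 1) (d - 17) <= 0].  The squares expanded in the proof are those of the
    deviations of the [m_i] from their mean. *)
Lemma degree_gt0 v : inter v v = 1 -> inter v K = - 3 -> 0 < inter v hyperplane.
Proof.
rewrite standard_inter standard_K !inter_lin inter_sumr.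
set d := inter v hyperplane; pose m i := inter v (exc i).
rewrite -/(\sum_i m i) -/(\sum_i m i * m i) => vv vK.
have : 0 <= \sum_i (m i * 8 - 3 * (d - 1)) ^+ 2.
  by apply: sumr_ge0 => i _; exact: sqr_ge0.
have -> : \sum_i (m i * 8 - 3 * (d - 1)) ^+ 2 =
    \sum_i (m i * m i * 64 + m i * (- 48 * (d - 1)) + 9 * (d - 1) ^+ 2).
  by apply: eq_bigr => i _; ring.
rewrite !big_split /= -!mulr_suml sumr_const card_ord.
have -> : \sum_i m i * m i = d * d - 1 by lia.
have -> : \sum_i m i = 3 * (d - 1) by lia.
move=> ge0; nia.
Qed.

Lemma sorting_perm n (m : 'I_n -> int) :
  exists s : 'S_n, forall i j : 'I_n, (i <= j)%N -> m (s j) <= m (s i).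
Proof.
pose t := [tuple m i | i < n].
have /tuple_permP[s ts] : perm_eq (sort >=%O t) t by rewrite perm_sort.
exists s => i j ij.
have sorted_t : sorted >=%O (sort >=%O t).
  by apply: sort_sorted; exact: ge_total.
have size_t : size (sort >=%O t) = n by rewrite size_sort size_tuple.
have nthE (k : 'I_n) : nth 0 (sort >=%O t) k = m (s k).
  by rewrite ts -tnth_nth !tnth_mktuple.
rewrite -!nthE; apply: (sorted_leq_nth _ _ _ sorted_t) => //.
- by move=> x y z yx xz; exact: le_trans xz yx.
- exact: lexx.
- by rewrite !inE size_t.
- by rewrite !inE size_t.
Qed.

(** The second alternative is the degree 3 class with seven multiplicities 1 and
    one multiplicity -1. *)
Lemma noether_inequality v : inter v v = 1 -> inter v K = - 3 ->
    (forall i j k, uniq [:: i; j; k] ->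
      inter v (exc i) + inter v (exc j) + inter v (exc k)
        <= inter v hyperplane) ->
  v = hyperplane \/ exists i, v = exc i *+ 2 - K.
Proof.
move=> vv vK noe; have d0 := degree_gt0 vv vK.
rewrite standard_inter in vv; rewrite standard_K !inter_lin inter_sumr in vK.
have [s srt] := sorting_perm (fun i => inter v (exc i)).
rewrite (reindex_inj (@perm_inj _ s)) in vv.
rewrite (reindex_inj (@perm_inj _ s)) in vK.
pose o (k : nat) : 'I_8 := inord k; pose m k := inter v (exc (s (o k))).
have mono j k : (j <= k < 8)%N -> m k <= m j.
  by move=> /andP[jk k8]; apply: srt; rewrite !inordK // (leq_ltn_trans jk).
have sumE (V : zmodType) (F : 'I_8 -> V) : \sum_i F i =
    F (o 0%N) + F (o 1%N) + F (o 2%N) + F (o 3%N) + F (o 4%N)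
    + F (o 5%N) + F (o 6%N) + F (o 7%N).
  rewrite !big_ord_recr big_ord0 /= add0r.
  by do 7?[congr (_ + _)]; congr F; apply: val_inj; rewrite /= inordK.
rewrite !sumE in vv vK.
have o_uniq : uniq [:: s (o 0%N); s (o 1%N); s (o 2%N)].
  by rewrite (map_inj_uniq (@perm_inj _ s) [:: o 0%N; o 1%N; o 2%N]) /=
    !inE -!val_eqE /= !inordK.
have := standard_expansion v; rewrite (reindex_inj (@perm_inj _ s)).
have [] := noether_sorted (d := inter v hyperplane) (m0 := m 0%N) (m1 := m 1%N)
  (m2 := m 2%N) (m3 := m 3%N) (m4 := m 4%N) (m5 := m 5%N) (m6 := m 6%N)
  (m7 := m 7%N).
- exact: d0.
- by split; apply: mono.
- by split; apply: mono.
- exact: noe o_uniq.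
- by rewrite /m; clear -vK; lia.
- by rewrite /m; clear -vv; lia.
- move=> [-> m0 m7] ->; left; rewrite scale1r big1 ?subr0 // => i _.
  have /eqP -> : inter v (exc (s i)) == 0; last by rewrite scale0r.
  rewrite eq_le -{1}m0 -m7 !srt // inordK //.
  by rewrite -ltnS.
- move=> [-> m0 m6 m7] ->; right; exists (s (o 7%N)).
  have -> : \sum_j inter v (exc (s j)) *: exc (s j)
      = \sum_j exc (s j) - exc (s (o 7%N)) *+ 2.
    rewrite (bigD1 (o 7%N)) //= [in RHS](bigD1 (o 7%N)) //= -/(m 7%N) m7.
    rewrite addrAC mulr2n opprD addrA subrr sub0r scaleN1r; congr (_ + _).
    apply: eq_bigr => i; rewrite -val_eqE /= inordK // => i7.
    have i6 : (i <= 6)%N by rewrite -ltnS ltn_neqAle i7 -ltnS ltn_ord.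
    have /eqP -> : inter v (exc (s i)) == 1; last by rewrite scale1r.
    by rewrite eq_le -{1}m0 -m6 !srt // inordK.
  rewrite standard_K [in RHS](reindex_inj (@perm_inj _ s)) !opprB addrCA.
    by rewrite scaler_nat.
Qed.

(** Descent on the degree.  If three multiplicities of [v] add up to more than its
    degree, the reflection in the root [h - e_i - e_j - e_k] (a quadratic Cremona
    transformation) lowers the degree, which stays positive; both alternatives are
    transported back by the same reflection, as it preserves the form and fixes
    [K].  Otherwise [noether_inequality] applies. *)
Lemma frame_or_double v : inter v v = 1 -> inter v K = - 3 ->
  (exists T, frame T v) \/ (exists2 l, lines l & v = l *+ 2 - K).
Proof.
have [n] := ubnP `|inter v hyperplane|%N.
elim: n v => // n IHn v; rewrite ltnS => dn vv vK.
have [|small] := boolP [exists i, exists j, exists k,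
    uniq [:: i; j; k] && (inter v hyperplane <
      inter v (exc i) + inter v (exc j) + inter v (exc k))]; last first.
  have [i j k ijk||[i ->]] := noether_inequality vv vK; last first.
  - by right; exists (exc i) => //; split; rewrite /= ?exc_K // exc_exc eqxx.
  - move=> ->; left.
    by exists [fset exc i | i in 'I_8]%fset; exact: standard_frame.
  - rewrite leNgt; apply: contra small => big.
    by do 3![apply/existsP; eexists]; apply/andP; split; last exact: big.
move=> /existsP[i /existsP[j /existsP[k /andP[ijk big]]]].
pose a := hyperplane - exc i - exc j - exc k.
have [ij ik jk] : [/\ i != j, i != k & j != k].
  by move: ijk; rewrite /= !inE negb_or => /andP[/andP[]] ? ? /andP[].
have aa : inter a a = - 2.
  rewrite /a !inter_lin !(interC (exc _) hyperplane)
    hyperplane_self !hyperplane_exc !exc_exc.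
  by rewrite !eqxx !(eq_sym j) !(eq_sym k) (negPf ij) (negPf ik) (negPf jk).
have aK : inter a K = 0 by rewrite /a !inter_lin hyperplane_K !exc_K.
have ah : inter a hyperplane = 1.
  by rewrite /a !inter_lin !(interC (exc _) hyperplane)
    hyperplane_self !hyperplane_exc.
have va : inter v a < 0 by rewrite /a !inter_lin; lia.
clearbody a.
have rv : inter (reflection a v) (reflection a v) = 1.
  by rewrite inter_reflection.
have rK : inter (reflection a v) K = - 3.
  by rewrite -(reflection_fix (etrans (interC _ _) aK)) inter_reflection.
have lt_rd : (`|inter (reflection a v) hyperplane| < n)%N.
  have := degree_gt0 rv rK; have := degree_gt0 vv vK.
  by rewrite /reflection !inter_lin ah mulr1; lia.
have [[T [sT _ cT]]|[l ll vE]] := IHn _ lt_rd rv rK; [left|right].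
  exists [fset reflection a x | x in T]%fset; split=> //.
    exact: simplex_reflection.
  by rewrite center_reflection // cT reflectionMnD reflectionK //
    reflection_fix // interC.
exists (reflection a l); first exact: reflection_lines.
have fixNK : reflection a (- K) = - K.
  by rewrite reflection_fix // interNl interC aK oppr0.
by rewrite -fixNK -reflectionMnD -vE reflectionK.
Qed.

(** * The correspondence *)

(** A line [l] with [D + K = 2l - K] is orthogonal to all lines of every
    configuration with center [D], since these have product 2 with [D] and -1
    with [K]. *)
Lemma double_cornered P l : A3polytope P -> lines l ->
  center P + K = l *+ 2 - K -> cornered P.
Proof.
move=> AP ll PE; exists l => // x xP; have [_ /(_ x xP) lx _] := AP.
split=> //; have := A3polytope_inter_center AP xP.
have [_ xK] := lx.
have -> : center P = l *+ 2 - K - K by rewrite -PE addrK.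
by rewrite !inter_lin xK; lia.
Qed.

Lemma uncornered_frame P : A3polytope P -> ~ cornered P ->
  exists T, frame T (center P + K).
Proof.
move=> AP ncP.
have PP := A3polytope_center_self AP; have PK := A3polytope_center_K AP.
have vv : inter (center P + K) (center P + K) = 1.
  by rewrite !inter_lin (interC K (center P)) PP PK KK; lia.
have vK : inter (center P + K) K = - 3 by rewrite !inter_lin PK KK; lia.
have [//|[l ll vE]] := frame_or_double vv vK.
by case: ncP; exact: double_cornered AP ll vE.
Qed.

Theorem theorem14 (D D1 : Pic)
    (hD : exists P : {fset Pic}, [/\ A3polytope P, ~ cornered P & center P = D])
    (hD1 : D1 = D *+ 3 + K *+ 4) :
  skew_line 8 D1 /\
  forall T : {fset Pic}, simplex 8 T -> center T = D1 ->
    exists2 phi : Pic -> {fset Pic}, line_edge_identification D T phi &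
      [set [fset phi l | l in P]%fset | P in configuration D] = four_skew_edges T.
Proof.
have [P [AP ncP cP]] := hD.
have [T0 [sT0 vv cT0]] := uncornered_frame AP ncP; rewrite cP in vv cT0.
have D1E : D1 = (D + K) *+ 3 + K by rewrite hD1 mulrnDl (mulrSr K 3) addrA.
split; first by exists T0; rewrite // cT0 D1E.
move=> T sT cT; have fT : frame T (D + K) by split=> //; rewrite cT.
exists (line_pair T); first exact: line_pair_identification.
exact: configuration_image.
Qed.
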